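(* Let $K$ be a field of characteristic $0$. Let $M=(\mu_0,\mu_1,\ldots,\mu_n)$ be a multiplicity vector, let $\lambda\in K$, and let $f(x)=\sum_{j=0}^n c_j(x-\lambda)^j\in K[x]$ be a polynomial of degree $n$. Then $M$ equals the multiplicity vector $M_f(\lambda)$ of $f$ at $\lambda$ if and only if, for every $j\in\{0,1,\ldots,n\}$, $c_j=0$ holds exactly when $\mu_j\ge 1$.
   Context: A multiplicity vector is a vector $(\mu_0,\ldots,\mu_n)$ of nonnegative integers with $\mu_n=0$ such that $\mu_j\ge1$ implies $\mu_{j+1}=\mu_j-1$. For a polynomial $f$ of degree $n$ and $\lambda\in K$, the multiplicity vector of $f$ at $\lambda$ is $M_f(\lambda)=(\mu_0,\ldots,\mu_n)$ where $\mu_j$ is the multiplicity of $\lambda$ as a zero of the $j$th derivative $f^{(j)}(x)$ (multiplicity $0$ if $f^{(j)}(\lambda)\neq0$; otherwise the largest $\mu$ with $(x-\lambda)^\mu\mid f^{(j)}(x)$). *)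

(* Defs.v *)
From mathcomp Require Import all_boot all_algebra.

Set Implicit Arguments.
Unset Strict Implicit.
Unset Printing Implicit Defensive.

Import GRing.Theory.
Local Open Scope ring_scope.

Definition is_multiplicity_vector (n : nat) (M : n.+1.-tuple nat) : Prop :=
  tnth M ord_max = 0%N /\
  forall i j : 'I_n.+1, j = i.+1 :> nat ->
    (1 <= tnth M i)%N -> tnth M j = (tnth M i - 1)%N.

(* Intended for f of degree n (size f = n.+1) over a field of characteristic 0,
   so that every derivative involved is nonzero: mup x 0 is a junk value. *)
Definition multiplicity_vector (K : fieldType) (n : nat) (f : {poly K})
    (lambda : K) : n.+1.-tuple nat :=
  [tuple mup lambda f^`(j) | j < n.+1].

(* Main.v *)
Require Import Defs.
From mathcomp Require Import all_boot all_algebra.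

Import GRing.Theory.
Local Open Scope ring_scope.

(** A multiplicity vector is determined by its set of nonzero entries: the last
    entry is [0], and going down each entry is either [0] or one more than the
    next. In characteristic [0], [M_f(lambda)] is itself a multiplicity vector,
    and since [f^(j)(lambda) = j! c_j] its [j]-th entry is nonzero exactly when
    [c_j = 0]. *)

Lemma is_multiplicity_vector_inj (n : nat) (M N : n.+1.-tuple nat) :
  is_multiplicity_vector M -> is_multiplicity_vector N ->
  (forall j, (0 < tnth M j)%N = (0 < tnth N j)%N) -> M = N.
Proof.
move=> [Mn MS] [Nn NS] eq_supp.
(* [k] is the distance from [j] to the last index, so induction on [k] runs down the vector from the
   entry that is [0] in both. *)
suff eq_rev k (j : 'I_n.+1) : (j + k = n)%N -> tnth M j = tnth N j.
  apply: eq_from_tnth => j; apply: (eq_rev (n - j)%N).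
  by rewrite subnKC // -ltnS.
elim: k j => [|k IHk] j.
  rewrite addn0 => jn; have -> : j = ord_max by apply: val_inj.
  by rewrite Mn Nn.
move=> jkn; have ltj : (j.+1 < n.+1)%N
  by rewrite ltnS (leq_trans _ (eq_leq jkn)) // addnS ltnS leq_addr.
have eqS : tnth M (Ordinal ltj) = tnth N (Ordinal ltj).
  by apply: IHk; rewrite /= addSnnS.
have := eq_supp j; case: (posnP (tnth M j)) => [-> /esym|Mj_gt0 /esym Nj_gt0].
  by case: (tnth N j).
move: eqS; rewrite (MS j) // (NS j) // !subn1 => eq_pred.
by rewrite -(prednK Mj_gt0) eq_pred prednK.
Qed.

Lemma derivn_comp_XsubC (R : comNzRingType) (p : {poly R}) (a : R) k :
  (p \Po ('X - a%:P))^`(k) = p^`(k) \Po ('X - a%:P).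
Proof.
elim: k => // k IHk.
by rewrite !derivnS IHk deriv_comp derivB derivX derivC subr0 mulr1.
Qed.

(** The sum is an ordinary polynomial composed with the shift ['X - a%:P]. Derivation commutes with
    the shift, and evaluating at [a] becomes reading off a constant coefficient. *)
Lemma horner_derivn_sum_XsubC (R : comNzRingType) n (c : 'I_n.+1 -> R) (a : R)
    (j : 'I_n.+1) :
  (\sum_(i < n.+1) c i *: ('X - a%:P) ^+ i)^`(j).[a] = c j *+ j`!.
Proof.
have -> : \sum_(i < n.+1) c i *: ('X - a%:P) ^+ i =
          (\poly_(i < n.+1) c (inord i)) \Po ('X - a%:P).
  rewrite poly_def raddf_sum /=; apply: eq_bigr => i _.
  by rewrite comp_polyZ comp_Xn_poly inord_val.
rewrite derivn_comp_XsubC horner_comp !hornerE subrr horner_coef0.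
by rewrite coef_derivn addn0 coef_poly ltn_ord inord_val ffactnn.
Qed.

Lemma mulrn_eq0_pchar0 (K : fieldType) (charK0 : [pchar K] =i pred0) (x : K) n :
  (x *+ n == 0) = (x == 0) || (n == 0).
Proof. by rewrite -mulr_natr mulf_eq0 (iffLR (pcharf0P K) charK0). Qed.

(** The coefficient in degree [(size p).-1 - k] is the leading coefficient of [p] times a positive
    falling factorial, hence nonzero in characteristic 0. *)
Lemma derivn_neq0 (K : fieldType) (charK0 : [pchar K] =i pred0)
    (p : {poly K}) k :
  (k < size p)%N -> p^`(k) != 0.
Proof.
move=> ltk; apply/eqP => /(congr1 (fun q : {poly K} => q`_((size p).-1 - k))).
have le_k : (k <= (size p).-1)%N by rewrite -ltnS (ltn_predK ltk).
rewrite coef_derivn subnKC // coef0 => /eqP.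
rewrite mulrn_eq0_pchar0 // -lead_coefE lead_coef_eq0 -size_poly_eq0.
by rewrite !eqn0Ngt ffact_gt0 le_k (leq_ltn_trans _ ltk).
Qed.

Lemma mup_deriv (K : fieldType) (charK0 : [pchar K] =i pred0)
    (x : K) (p : {poly K}) :
  p != 0 -> (0 < mup x p)%N -> mup x p^`() = (mup x p).-1.
Proof.
move=> p_neq0; have [m [q]] := multiplicity_XsubC p x.
rewrite p_neq0 /= => qx ->.
rewrite mupMr // mup_XsubCX eqxx; case: m => // m _.
rewrite derivM deriv_exp derivB derivX derivC subr0 mul1r /=.
(* Pulling out [('X - x%:P) ^+ m] leaves the cofactor q' (X - x) + (m+1) q, whose value (m+1) q(x)
   at [x] is nonzero in characteristic 0. *)
rewrite mulrnAr -mulrnAl exprSr mulrA mulrAC -mulrDl mupMr ?mup_XsubCX ?eqxx //.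
rewrite rootE !hornerE subrr mulr0 add0r hornerMn mulrn_eq0_pchar0 //.
by rewrite orbF -rootE.
Qed.

Lemma mup_gt0 (K : fieldType) (x : K) (p : {poly K}) :
  p != 0 -> (0 < mup x p)%N = root p x.
Proof. by move=> p_neq0; rewrite -XsubC_dvd // dvdp_XsubCl. Qed.

Lemma multiplicity_vectorP (K : fieldType) (charK0 : [pchar K] =i pred0) n
    (f : {poly K}) (x : K) :
  size f = n.+1 -> is_multiplicity_vector (multiplicity_vector n f x).
Proof.
move=> sz_f; have nz (j : 'I_n.+1) : f^`(j) != 0.
  by rewrite derivn_neq0 // sz_f.
split=> [|i j ji]; rewrite !tnth_mktuple; last first.
  by rewrite ji derivnS subn1; apply: mup_deriv.
(* The last entry is [0] because the [n]-th derivative is a nonzero constant. *)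
have /size_poly1P[c c_neq0 ->] : size f^`(n) == 1%N.
  rewrite eqn_leq lt0n size_poly_eq0 (nz ord_max) andbT.
  apply/leq_sizeP => i i_gt0; rewrite coef_derivn nth_default ?mul0rn //.
  by rewrite sz_f -addn1 leq_add2l.
by rewrite mupNroot // rootC.
Qed.

Theorem theorem2 (K : fieldType) (charK0 : [pchar K] =i pred0) (n : nat)
    (M : n.+1.-tuple nat) (hM : is_multiplicity_vector M)
    (lambda : K) (c : 'I_n.+1 -> K) (f : {poly K})
    (hf : f = \sum_(j < n.+1) c j *: ('X - lambda%:P) ^+ j)
    (degf : size f = n.+1) :
  M = multiplicity_vector n f lambda <->
  (forall j : 'I_n.+1, c j = 0 <-> (1 <= tnth M j)%N).
Proof.
(* This gives the forward direction at once; for the converse it shows that [M] and the vector of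
   [f] have the same support. *)
have supp j : (0 < tnth (multiplicity_vector n f lambda) j)%N = (c j == 0).
  rewrite tnth_mktuple mup_gt0 ?derivn_neq0 ?degf //.
  rewrite rootE hf horner_derivn_sum_XsubC mulrn_eq0_pchar0 //.
  by rewrite (eqn0Ngt j`!) fact_gt0 orbF.
split=> [-> j|eq_supp].
  by rewrite supp; split=> /eqP.
apply: is_multiplicity_vector_inj => // [|j].
  exact: multiplicity_vectorP.
by rewrite supp; apply/idP/eqP => /eq_supp.
Qed.
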